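(* Let $n\ge 1$ and let $X$ be a finite pure $n$-dimensional simplicial complex. Assume that there are $\kappa \geq \lambda >\frac{n-1}{n}$ such that $X$ has two-sided $(\lambda,\kappa)$-local spectral expansion. Then for every $-1\le k\le n-2$ and every $k$-dimensional simplex $\tau$ of $X$, $$f^{n-k-2} (\lambda) \leq \lambda (X_\tau) \quad\text{ and }\quad \kappa (X_\tau) \leq f^{n-k-2} (\kappa),$$ where $\lambda (X_\tau)$, $\kappa (X_\tau)$ are the smallest and largest positive eigenvalues of the (weighted) Laplacian of the $1$-skeleton of $X_\tau$, $f(x)=2-\frac{1}{x}$ and $f^l$ denotes $f$ composed with itself $l$ times ($f^0(x)=x$); explicitly, $$f^l (x) = \dfrac{(l+1)x-l}{l x -(l-1)}.$$
   Context: $X$ is pure $n$-dimensional if every simplex of $X$ is a face of an $n$-dimensional simplex. $X^{(j)}$ is the set of $j$-simplices, with $X^{(-1)}=\{\emptyset\}$. For $\tau\in X^{(k)}$, the link $X_\tau$ is the complex of all simplices $\sigma$ of $X$ disjoint from $\tau$ with $\tau\cup\sigma$ a simplex of $X$; it is pure of dimension $n-k-1$, and $X_\emptyset=X$. Homogeneous weight: for $\tau\in X^{(k)}$, $-1\le k\le n$, $m(\tau)=(n-k)!\,|\{\sigma\in X^{(n)}:\tau\subseteq\sigma\}|$. Weighted Laplacian of the $1$-skeleton of $X_\tau$ ($\tau \in X^{(k)}$, $-1\le k\le n-2$): the operator on real functions on the vertices of $X_\tau$ given by $$(\Delta^+_{\tau,0}\phi)(u)=\phi(u)-\sum_{v:\{u,v\}\in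 X_\tau^{(1)}}\frac{m(\tau\cup\{u,v\})}{m(\tau\cup\{u\})}\phi(v).$$ It is self-adjoint and non-negative for the inner product $\langle\phi,\psi\rangle=\sum_u m(\tau\cup\{u\})\phi(u)\psi(u)$. For $\tau\in X^{(n-2)}$ the link $X_\tau$ is a graph and this operator is the usual (normalized) graph Laplacian up to conjugation. $\lambda(X_\tau)$ and $\kappa(X_\tau)$ denote its smallest and largest positive eigenvalues. Two-sided $(\lambda,\kappa)$-local spectral expansion (for $\lambda>\frac{n-1}{n}$, $\kappa<2$): the $1$-skeleton of $X$ and the $1$-skeletons of all its links of dimension $>0$ are connected, and for every $\sigma\in X^{(n-2)}$, $\lambda(X_\sigma)\ge\lambda$ and $\kappa(X_\sigma)\le\kappa$. *)

(* Defs.v *)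
From mathcomp Require Import all_boot all_order all_algebra.
From mathcomp Require classical_sets.
From mathcomp Require Import reals.

Set Implicit Arguments.
Unset Strict Implicit.
Unset Printing Implicit Defensive.

Import Order.TTheory GRing.Theory Num.Theory.
Local Open Scope ring_scope.

Section Complexes.
Variable V : finType.
Implicit Types (X Y : {set {set V}}) (sigma tau : {set V}) (n : nat) (k : int).

(* The empty simplex belongs to X; elements of V that span no simplex of X
   are allowed and are not vertices of X. *)
Definition simplicial_complex X : Prop :=
  set0 \in X /\
  forall sigma tau, sigma \in X -> tau \subset sigma -> tau \in X.

(* X^(k): a k-dimensional simplex has k + 1 vertices; k = -1 gives {set0}. *)
Definition simplices X k : {set {set V}} :=
  [set sigma in X | #|sigma|%:Z == k + 1].

Definition pure_dim n X : Prop :=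
  forall sigma, sigma \in X ->
    exists2 tau, tau \in simplices X n%:Z & sigma \subset tau.

Definition link X tau : {set {set V}} :=
  [set sigma in X | [disjoint tau & sigma] & (tau :|: sigma \in X)].

Definition vertex Y : finType := {v : V | [set v] \in Y}.

Definition edge Y (u v : vertex Y) : bool :=
  [set val u; val v] \in simplices Y 1.

(* Connectedness of the 1-skeleton. *)
Definition connected_skeleton Y : Prop :=
  forall u v : vertex Y, connect (@edge Y) u v.

(* (n - k)! with k = #|tau| - 1. *)
Definition weight n X tau : nat :=
  ((n.+1 - #|tau|)`! * #|[set sigma in simplices X n%:Z | tau \subset sigma]|)%N.

End Complexes.

Section Spectrum.
Variables (R : realType) (V : finType).
Implicit Types (X : {set {set V}}) (tau : {set V}).

(* R^o is R seen as a vector space over itself, so that *: is available. *)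
Definition laplacian (n : nat) X tau (phi : {ffun vertex (link X tau) -> R^o}) :
    {ffun vertex (link X tau) -> R^o} :=
  [ffun u => phi u -
     \sum_(v | edge u v)
        (weight n X (tau :|: [set val u; val v]))%:R
        / (weight n X (tau :|: [set val u]))%:R * phi v].

Definition positive_eigenvalue (n : nat) X tau (a : R) : Prop :=
  0 < a /\
  exists2 phi : {ffun vertex (link X tau) -> R^o},
    phi != 0 & laplacian n phi = a *: phi.

(* The default 0 of xget is only reached when there is no positive eigenvalue;
   the set of eigenvalues is finite. *)
Definition lambda_link (n : nat) X tau : R :=
  classical_sets.xget 0 (fun a => positive_eigenvalue n X tau a /\
    forall b, positive_eigenvalue n X tau b -> a <= b).

Definition kappa_link (n : nat) X tau : R :=
  classical_sets.xget 0 (fun a => positive_eigenvalue n X tau a /\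
    forall b, positive_eigenvalue n X tau b -> b <= a).

(* The link of a k-simplex has dimension n - k - 1, which is positive iff
   k <= n - 2. *)
Definition two_sided_expansion (n : nat) X (lambda kappa : R) : Prop :=
  [/\ (n%:R - 1) / n%:R < lambda,
      kappa < 2,
      connected_skeleton X,
      (forall (k : int) tau, -1 <= k <= n%:Z - 2 -> tau \in simplices X k ->
         connected_skeleton (link X tau))
    & (forall sigma, sigma \in simplices X (n%:Z - 2) ->
         lambda <= lambda_link n X sigma /\ kappa_link n X sigma <= kappa)].

Definition f (x : R) : R := 2 - x^-1.

End Spectrum.

(* Main.v *)
Require Import Defs.
From mathcomp Require Import all_boot all_order all_algebra.
From mathcomp Require Import reals.
From mathcomp Require classical_sets.
From mathcomp Require Import boolp spectral complex polyrcf zify ring lra.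

Set Implicit Arguments.
Unset Strict Implicit.
Unset Printing Implicit Defensive.

Import Order.TTheory GRing.Theory Num.Theory.
Local Open Scope ring_scope.

(** The proof is the trickling-down argument of Oppenheim, in the style of
Garland.

A simplex t of dimension at most n - 2 gives a weighted graph on V: the weight
of {u, v} is m(t + {u, v}).  Because m is balanced, i.e. m(s) is the sum of
m(s + v) over the vertices v outside s (weight_balance), the degree of u in this
graph is m(t + u), and the Laplacian of X_t is the normalized Laplacian of the
graph.  The same balance equation makes the graphs of the links X_(t + v) sum to
the graph of X_t, while the degree of u in the graph of X_(t + v) is the weight
of the edge {v, u} in the graph of X_t.

Let phi be an eigenfunction of the Laplacian of X_t with eigenvalue a > 0 and
squared norm N.  The Dirichlet energies of phi on the links X_(t + v) add up to
its energy on X_t, which is a N.  On X_(t + v) the mean of phi is the value at v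
of the random walk operator applied to phi, that is (1 - a) phi(v); so the
variances of phi on these links add up to N - (1 - a)^2 N = a (2 - a) N.  If all
positive eigenvalues on the links lie in [c, d], the Poincare inequalities
  c * variance <= energy <= d * variance
hold on each link (poincare_lower, poincare_upper; the former needs the link to
be connected).  Summing, c (2 - a) <= 1 <= d (2 - a), which says
f(c) <= a <= f(d) (trickle_down_lower, trickle_down_upper).  Descending from
dimension n - 2 to the dimension of t applies f once per dimension
(spectral_gap_descent); the hypothesis lambda > (n - 1) / n keeps all the iterates
involved positive (iter_f_gt).

The Poincare inequalities come from the spectral theorem for symmetric matrices
(symmetric_psd).  The smallest and largest positive eigenvalues are attained
because there are finitely many eigenvalues and at least one positive one
(lambda_linkP, kappa_linkP). *)

(** * Positivity of symmetric forms from their spectrum *)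

(** Diagonalize over the complex numbers: the matrix is Hermitian there, its
spectral values are real, hence they are eigenvalues over R. *)
Lemma symmetric_psd (R : rcfType) n (A : 'M[R]_n) :
  A^T = A -> (forall a, eigenvalue A a -> 0 <= a) ->
  forall x : 'rV[R]_n, 0 <= (x *m A *m x^T) 0 0.
Proof.
move=> symA eigA x.
pose toC := map_mx (real_complex R).
pose AC : 'M[R[i]%C]_n := toC _ _ A.
pose conjmx m1 m2 (M : 'M[R[i]%C]_(m1, m2)) := map_mx Num.conj M^T.
have realE m1 m2 (M : 'M[R]_(m1, m2)) : map_mx Num.conj (toC _ _ M) = toC _ _ M.
  by apply/matrixP => i j; rewrite !mxE; apply: conjc_real.
have hA : AC \is hermsymmx.
  apply/is_hermitianmxP; rewrite expr0 scale1r map_trmx realE.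
  by rewrite symA.
have /orthomx_spectralP AE := hermitian_normalmx hA.
set P := spectralmx AC in AE; set d := spectral_diag AC in AE.
have Pu : P \in unitmx := spectral_unit AC.
have PV : invmx P = conjmx _ _ P.
  by rewrite invmx_unitary ?spectral_unitarymx // /conjmx map_trmx.
have d_ge0 j : 0 <= d 0 j.
  have /mxOverP/(_ 0 j)/complex_realP[r dE] := hermitian_spectral_diag_real hA.
  rewrite -/d in dE; rewrite dE ler0c; apply: eigA.
  rewrite -(eigenvalue_map (real_complex R)); apply/eigenvalueP.
  exists (row j P).
    rewrite -/(toC n n A) -/AC {1}AE -row_mul !mulmxA mulmxV // mul1mx row_mul.
    by rewrite row_diag_mx -scalemxAl -rowE dE.
  apply/eqP => P0; have := row_free_unit P; rewrite Pu => /row_freeP[Q PQ].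
  have := congr1 (row j) PQ; rewrite row_mul P0 mul0mx => /rowP/(_ j).
  by rewrite !mxE eqxx => /eqP; rewrite eq_sym oner_eq0.
pose y := toC _ _ x *m conjmx _ _ P.
have formE : real_complex R ((x *m A *m x^T) 0 0) =
    (y *m diag_mx d *m conjmx _ _ y) 0 0.
  transitivity (toC _ _ (x *m A *m x^T) 0 0); first by rewrite [RHS]mxE.
  rewrite /toC !map_mxM -/toC -/(toC _ _ A) -/AC AE PV.
  rewrite /y {3}/conjmx trmx_mul map_mxM /= -!map_trmx realE.
  have -> : (map_mx Num.conj (conjmx _ _ P))^T = P.
    by rewrite map_trmx; apply: trmxCK.
  by rewrite !mulmxA.
rewrite -ler0c formE mul_mx_diag mxE sumr_ge0 // => j _.
rewrite /conjmx !mxE mulrAC mulr_ge0 //.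
exact: mul_conjC_ge0.
Qed.

Section WeightedForms.
Variables (R : rcfType) (T : finType).
Implicit Types (w phi : T -> R) (s : T -> T -> R) (a : R).

(** Generalized eigenpairs of the form s relative to the diagonal form w. The
weight w may vanish, so phi is required to be nonzero where w is. *)
Definition eigenpair w s a phi : Prop :=
  (exists2 u, w u != 0 & phi u != 0) /\
  forall u, \sum_v s u v * phi v = a * (w u * phi u).

(** Conjugating by the square roots of the weights turns the generalized
eigenproblem into that of a symmetric matrix. The convention 0^-1 = 0 makes the
rows of weight 0 vanish, which creates no spurious nonzero eigenvalue. *)
Definition normalized_mx w s : 'M[R]_#|T| :=
  \matrix_(i, j) (s (enum_val i) (enum_val j) /
    (Num.sqrt (w (enum_val i)) * Num.sqrt (w (enum_val j)))).

Lemma sum_enum_rank (F : 'I_#|T| -> R) :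
  \sum_i F i = \sum_u F (enum_rank u).
Proof. by rewrite (reindex enum_rank) //; apply/onW_bij/enum_rank_bij. Qed.

Variables (w : T -> R) (s : T -> T -> R).
Hypotheses (w_ge0 : forall u, 0 <= w u) (s_sym : forall u v, s u v = s v u)
  (s_supp : forall u v, w u = 0 -> s u v = 0).

Let sqrtw_eq0 u : (Num.sqrt (w u) == 0) = (w u == 0).
Proof. by rewrite sqrtr_eq0 le_eqVlt ltNge w_ge0 orbF. Qed.

Let sqrtwK u : Num.sqrt (w u) * Num.sqrt (w u) = w u.
Proof. by rewrite -expr2 sqr_sqrtr. Qed.

Let s_div u v : s u v / (Num.sqrt (w u) * Num.sqrt (w v)) * Num.sqrt (w v)
  = s u v / Num.sqrt (w u).
Proof.
have [wv|wv] := eqVneq (w v) 0; first by rewrite s_sym s_supp ?mul0r.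
by rewrite invfM mulrA mulfVK // sqrtw_eq0.
Qed.

Lemma eigenpair_normalized a phi :
  eigenpair w s a phi -> eigenvalue (normalized_mx w s) a.
Proof.
move=> [[u wu phiu] phiE]; apply/eigenvalueP.
exists (\row_i (Num.sqrt (w (enum_val i)) * phi (enum_val i))); last first.
  apply/eqP => /rowP/(_ (enum_rank u)); rewrite !mxE enum_rankK => /eqP.
  by rewrite mulf_eq0 sqrtw_eq0 (negPf wu) (negPf phiu).
apply/rowP => j; rewrite !mxE sum_enum_rank; set v := enum_val j.
transitivity ((\sum_x s v x * phi x) / Num.sqrt (w v)).
  rewrite mulr_suml; apply: eq_bigr => x _; rewrite !mxE !enum_rankK -/v.
  rewrite mulrC mulrA [Num.sqrt (w x) * _]mulrC s_sym s_div.
  by rewrite mulrAC.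
rewrite phiE -{1}sqrtwK; have [wv|wv] := eqVneq (Num.sqrt (w v)) 0.
  by rewrite wv !(mul0r, mulr0).
by field.
Qed.

Lemma normalized_eigenpair a :
  a != 0 -> eigenvalue (normalized_mx w s) a -> exists phi, eigenpair w s a phi.
Proof.
move=> a0 /eigenvalueP[x /rowP xE x0].
pose psi u := x 0 (enum_rank u).
have psiE u : \sum_v s u v * (psi v / Num.sqrt (w v)) / Num.sqrt (w u) = a * psi u.
  have := xE (enum_rank u); rewrite !mxE sum_enum_rank => <-.
  apply: eq_bigr => v _; rewrite !mxE !enum_rankK s_sym /psi invfM; ring.
have psi0 u : w u = 0 -> psi u = 0.
  move=> wu; apply/eqP; rewrite -(mulrI_eq0 _ (mulfI a0)) -psiE.
  by rewrite big1 // => v _; rewrite s_supp ?mul0r.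
exists (fun u => psi u / Num.sqrt (w u)); split.
  have /rV0Pn[i xi] := x0; exists (enum_val i).
    apply: contra_neq xi => /psi0; rewrite /psi enum_valK.
    by move->.
  have psii : psi (enum_val i) != 0 by rewrite /psi enum_valK.
  rewrite mulf_neq0 // invr_eq0 sqrtw_eq0.
  by apply: contra_neq psii; apply: psi0.
move=> u; have [wu|wu] := eqVneq (w u) 0.
  by rewrite wu mul0r mulr0 big1 // => v _; rewrite s_supp ?mul0r.
have su : Num.sqrt (w u) != 0 by rewrite sqrtw_eq0.
rewrite -[LHS](mulfVK su) mulr_suml psiE -{2}sqrtwK; by field.
Qed.

Lemma form_psd :
  (forall a phi, eigenpair w s a phi -> 0 <= a) ->
  forall phi, 0 <= \sum_u \sum_v s u v * phi u * phi v.
Proof.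
move=> eig phi; pose x : 'rV[R]_#|T| :=
  \row_i (Num.sqrt (w (enum_val i)) * phi (enum_val i)).
suff -> : \sum_u \sum_v s u v * phi u * phi v =
    (x *m normalized_mx w s *m x^T) 0 0.
  apply: symmetric_psd => [|a].
    by apply/matrixP => i j; rewrite !mxE s_sym [X in _ / X]mulrC.
  have [->//|a0] := eqVneq a 0.
  by move=> /(normalized_eigenpair a0)[psi /eig].
rewrite mxE sum_enum_rank exchange_big; apply: eq_bigr => v _ /=.
rewrite !mxE sum_enum_rank mulr_suml; apply: eq_bigr => u _.
rewrite !mxE !enum_rankK.
transitivity (s u v / (Num.sqrt (w u) * Num.sqrt (w v)) * Num.sqrt (w v)
   * Num.sqrt (w u) * phi u * phi v); last by ring.
rewrite s_div; have [wu|wu] := eqVneq (w u) 0; first by rewrite s_supp ?mul0r.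
by rewrite mulfVK // sqrtw_eq0.
Qed.

Lemma eigenvalues_finite :
  exists r : seq R, forall a phi, eigenpair w s a phi -> a \in r.
Proof.
exists (rootsR (char_poly (normalized_mx w s))) => a phi /eigenpair_normalized.
rewrite eigenvalue_root_char => ra.
have p0 : char_poly (normalized_mx w s) != 0 by rewrite monic_neq0 ?char_poly_monic.
by apply: (root_roots_on (roots_on_rootsR p0)).
Qed.

End WeightedForms.

(** With r the order or its converse, and P holding at the positive eigenvalues,
this shows that lambda_link and kappa_link are not the default value of xget. *)
Lemma seq_extremum (T : eqType) (r : rel T) (P : T -> Prop) (l : seq T) :
  total r -> transitive r -> (forall a, P a -> a \in l) -> (exists a, P a) ->
  exists2 a, P a & forall b, P b -> r a b.
Proof.
move=> rT rt; elim: l P => [|c l IH] P Pl [a Pa]; first by have := Pl _ Pa.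
have rr x : r x x by case/orP: (rT x x).
have [[d [Pd dc]]|noP] := EM (exists d, P d /\ d != c).
  have [||m [Pm mc] minm] := IH (fun x => P x /\ x != c).
  - by move=> x [/Pl]; rewrite inE => /orP[->|].
  - by exists d.
  have [Pc|nPc] := EM (P c).
    case/orP: (rT m c) => mc'; [exists m => // b Pb|exists c => // b Pb].
    + by have [->//|bc] := eqVneq b c; apply: minm.
    + have [->//|bc] := eqVneq b c; apply: rt mc' _; exact: minm.
  exists m => // b Pb; apply: minm; split=> //.
  by apply/eqP => bc; apply: nPc; rewrite -bc.
have Pc x : P x -> x = c.
  by move=> Px; apply: contra_notP noP => /eqP xc; exists x.
by exists a => // b Pb; rewrite (Pc _ Pb) (Pc _ Pa).
Qed.

(** * Weighted graphs and Poincare inequalities *)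

Section WeightedGraphs.
Variables (R : rcfType) (V : finType).
Implicit Types (g : V -> V -> R) (phi : V -> R) (a b c : R).

Definition deg g u : R := \sum_v g u v.

(** The normalized Laplacian multiplied by the degrees: this makes it a
symmetric form, and its eigenpairs relative to deg are those of the normalized
Laplacian. *)
Definition lap g u v : R := (u == v)%:R * deg g u - g u v.

Definition dirichlet g phi : R := \sum_u phi u * \sum_v lap g u v * phi v.

Definition sqnorm g phi : R := \sum_u deg g u * phi u ^+ 2.

Definition mean g phi : R := (\sum_u deg g u * phi u) / \sum_u deg g u.

Definition variance g phi : R :=
  sqnorm g phi - (\sum_u deg g u * phi u) ^+ 2 / \sum_u deg g u.

Definition lap_eigenpair g := eigenpair (deg g) (lap g).

Definition weighted_graph g : Prop :=
  (forall u v, 0 <= g u v) /\ (forall u v, g u v = g v u).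

(** Points of degree 0 are not vertices of the graph. *)
Definition graph_connected g : Prop :=
  forall u v, deg g u != 0 -> deg g v != 0 -> connect [rel x y | 0 < g x y] u v.

Lemma lap_apply g phi u :
  \sum_v lap g u v * phi v = deg g u * phi u - \sum_v g u v * phi v.
Proof.
under eq_bigr do rewrite mulrBl; rewrite sumrB (bigD1 u) //= eqxx mul1r.
by rewrite big1 ?addr0 // => v; rewrite eq_sym => /negPf->; rewrite !mul0r.
Qed.

Lemma sum_lap g phi : weighted_graph g -> \sum_u \sum_v lap g u v * phi v = 0.
Proof.
move=> [_ gC]; under eq_bigr do rewrite lap_apply; rewrite sumrB.
apply/eqP; rewrite subr_eq0; apply/eqP.
rewrite exchange_big; apply: eq_bigr => u _; rewrite mulr_suml.
by apply: eq_bigr => v _; rewrite gC.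
Qed.

Lemma dirichletE g phi :
  dirichlet g phi = sqnorm g phi - \sum_u phi u * \sum_v g u v * phi v.
Proof.
rewrite -sumrB; apply: eq_bigr => u _; rewrite lap_apply; ring.
Qed.

Lemma dirichlet_squares g phi : weighted_graph g ->
  dirichlet g phi *+ 2 = \sum_u \sum_v g u v * (phi u - phi v) ^+ 2.
Proof.
move=> [_ gC]; rewrite dirichletE.
have sE : sqnorm g phi = \sum_u \sum_v g u v * phi u ^+ 2.
  by apply: eq_bigr => u _; rewrite mulr_suml.
have sE' : sqnorm g phi = \sum_u \sum_v g u v * phi v ^+ 2.
  rewrite sE exchange_big; apply: eq_bigr => u _.
  by apply: eq_bigr => v _; rewrite gC.
have s2 : sqnorm g phi *+ 2 = \sum_u \sum_v g u v * (phi u ^+ 2 + phi v ^+ 2).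
  rewrite mulr2n {1}sE sE' -big_split; apply: eq_bigr => u _.
  by rewrite -big_split; apply: eq_bigr => v _; rewrite /= mulrDr.
rewrite mulrnBl s2 -sumrMnl -sumrB; apply: eq_bigr => u _.
rewrite mulr_sumr -sumrMnl -sumrB; apply: eq_bigr => v _; ring.
Qed.

Section Graph.
Variable g : V -> V -> R.
Hypothesis gG : weighted_graph g.

Let g_ge0 : forall u v, 0 <= g u v. Proof. by case: gG. Qed.
Let gC : forall u v, g u v = g v u. Proof. by case: gG. Qed.

Lemma deg_ge0 u : 0 <= deg g u.
Proof. exact: sumr_ge0. Qed.

Lemma deg0 u v : deg g u = 0 -> g u v = 0.
Proof. by move=> /psumr_eq0P->. Qed.

Lemma dirichlet_ge0 phi : 0 <= dirichlet g phi.
Proof.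
rewrite -(pmulrn_lge0 _ (ltn0Sn 1)) dirichlet_squares //.
apply: sumr_ge0 => u _; apply: sumr_ge0 => v _.
by rewrite mulr_ge0 ?sqr_ge0.
Qed.

Lemma dirichlet0_edge phi u v : dirichlet g phi = 0 -> 0 < g u v -> phi u = phi v.
Proof.
move=> d0 guv; have sq0 x y : 0 <= g x y * (phi x - phi y) ^+ 2.
  by rewrite mulr_ge0 ?sqr_ge0.
have /esym := dirichlet_squares phi gG; rewrite d0 mul0rn => /psumr_eq0P h.
have /psumr_eq0P/(_ v isT) := h (fun x _ => sumr_ge0 _ (fun y _ => sq0 x y)) u isT.
move=> /(_ (fun y _ => sq0 u y))/eqP.
by rewrite mulf_eq0 gt_eqF //= sqrf_eq0 subr_eq0 => /eqP.
Qed.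

Lemma dirichlet_eigenpair a phi :
  lap_eigenpair g a phi -> dirichlet g phi = a * sqnorm g phi.
Proof.
move=> [_ phiE]; rewrite /sqnorm mulr_sumr; apply: eq_bigr => u _.
rewrite phiE; ring.
Qed.

Lemma eigenpair_sqnorm a phi : lap_eigenpair g a phi -> 0 < sqnorm g phi.
Proof.
move=> [[u du pu] _]; rewrite lt_neqAle eq_sym.
have t_ge0 x : 0 <= deg g x * phi x ^+ 2 by rewrite mulr_ge0 ?deg_ge0 ?sqr_ge0.
rewrite sumr_ge0 ?andbT //; apply: contra_neqN du => /eqP/psumr_eq0P.
move=> /(_ (fun x _ => t_ge0 x) u isT)/eqP.
by rewrite mulf_eq0 sqrf_eq0 (negPf pu) orbF => /eqP.
Qed.

Lemma lap_sym u v : lap g u v = lap g v u.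
Proof.
rewrite /lap eq_sym gC; have [->//|_] := eqVneq v u.
by rewrite !mul0r.
Qed.

Lemma lap_supp u v : deg g u = 0 -> lap g u v = 0.
Proof. by move=> du; rewrite /lap du deg0 // mulr0 subr0. Qed.

Lemma harmonic_constant phi : graph_connected g -> dirichlet g phi = 0 ->
  forall u v, deg g u != 0 -> deg g v != 0 -> phi u = phi v.
Proof.
move=> gconn d0 u v du dv; have /connectP[p pth ->] := gconn u v du dv.
elim: p u pth {du} => //= x p IH u /andP[/(dirichlet0_edge d0)-> pth].
exact: IH.
Qed.

(** The symmetric form of the projection onto the complement of the constants;
its quadratic form is the variance. *)
Definition centered_form u v : R :=
  (u == v)%:R * deg g u - deg g u * deg g v / \sum_x deg g x.

Lemma centered_apply phi u : \sum_v centered_form u v * phi v =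
  deg g u * phi u - deg g u * mean g phi.
Proof.
under eq_bigr do rewrite mulrBl; rewrite sumrB (bigD1 u) //= eqxx mul1r.
rewrite big1 ?addr0 => [|v]; last first.
  by rewrite eq_sym => /negPf->; rewrite !mul0r.
congr (_ - _); rewrite /mean mulr_suml mulr_sumr.
by apply: eq_bigr => v _; ring.
Qed.

Lemma variance_centered phi :
  variance g phi = \sum_u phi u * \sum_v centered_form u v * phi v.
Proof.
rewrite /variance /sqnorm.
transitivity (\sum_u (deg g u * phi u ^+ 2 - deg g u * phi u * mean g phi)).
  by rewrite sumrB -mulr_suml /mean mulrA expr2.
by apply: eq_bigr => u _; rewrite centered_apply; ring.
Qed.

Lemma sum_centered phi : \sum_u \sum_v centered_form u v * phi v = 0.
Proof.
under eq_bigr do rewrite centered_apply; rewrite sumrB -mulr_suml.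
have [vol0|vol0] := eqVneq (\sum_u deg g u) 0; last first.
  by rewrite /mean mulrC mulfVK // subrr.
rewrite vol0 mul0r subr0 big1 // => u _.
by rewrite (psumr_eq0P _ vol0) ?mul0r // => ? _; exact: deg_ge0.
Qed.

Let pencil b c u v := b * lap g u v + c * centered_form u v.

Let pencil_apply b c phi u : \sum_v pencil b c u v * phi v =
  b * (\sum_v lap g u v * phi v) + c * \sum_v centered_form u v * phi v.
Proof.
rewrite !mulr_sumr -big_split; apply: eq_bigr => v _ /=; rewrite /pencil; ring.
Qed.

(** The pencil annihilates constants, so an eigenfunction of a nonzero eigenvalue
has mean 0, and on such functions the centered form is multiplication by deg. *)
Lemma eigenpair_pencil b c a phi : a != 0 ->
  eigenpair (deg g) (pencil b c) a phi ->
  \sum_u deg g u * phi u = 0 /\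
  forall u, b * (\sum_v lap g u v * phi v) = (a - c) * (deg g u * phi u).
Proof.
move=> a0 [_ phiE].
have s0 : \sum_u deg g u * phi u = 0.
  apply/eqP; rewrite -(mulrI_eq0 _ (mulfI a0)) mulr_sumr.
  under eq_bigr do rewrite -phiE pencil_apply.
  by rewrite big_split -!mulr_sumr /= sum_lap // sum_centered !mulr0 addr0.
split=> // u; have := phiE u; rewrite pencil_apply centered_apply /mean s0.
by rewrite mul0r mulr0 subr0 => h; rewrite mulrBl -h addrK.
Qed.

Lemma pencil_psd b c :
  (forall a phi, eigenpair (deg g) (pencil b c) a phi -> 0 <= a) ->
  forall phi, 0 <= b * dirichlet g phi + c * variance g phi.
Proof.
move=> h phi; suff -> : b * dirichlet g phi + c * variance g phi =
    \sum_u \sum_v pencil b c u v * phi u * phi v.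
  apply: form_psd h phi => [|u v|u v du].
  - exact: deg_ge0.
  - rewrite /pencil lap_sym /centered_form eq_sym; congr (_ + _ * (_ - _ / _)).
      by have [->//|] := eqVneq v u; rewrite !mul0r.
    by rewrite mulrC.
  - by rewrite /pencil lap_supp // /centered_form du !(mul0r, mulr0) subrr mulr0 addr0.
rewrite variance_centered /dirichlet !mulr_sumr -big_split.
apply: eq_bigr => u _ /=.
transitivity (phi u * \sum_v pencil b c u v * phi v).
  by rewrite pencil_apply; ring.
by rewrite mulr_sumr; apply: eq_bigr => v _; ring.
Qed.

(** A negative eigenvalue a of lap - c * centered_form would give the eigenvalue
a + c < c of lap, on a function of mean 0. It is nonnegative, and it is not 0
either: by connectedness a harmonic function is constant, hence 0. *)
Lemma poincare_lower c : graph_connected g ->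
  (forall a phi, 0 < a -> lap_eigenpair g a phi -> c <= a) ->
  forall phi, c * variance g phi <= dirichlet g phi.
Proof.
move=> gconn gap phi; rewrite -subr_ge0 -mulNr -[X in X + _]mul1r.
apply: pencil_psd => {phi} a phi ephi; rewrite leNgt; apply/negP => a_lt0.
have [s0 phiE] := eigenpair_pencil (negbT (lt_eqF a_lt0)) ephi.
have lphi : lap_eigenpair g (a + c) phi.
  by split=> [|u]; [case: ephi | rewrite -[LHS]mul1r phiE opprK].
have N0 := eigenpair_sqnorm lphi.
have := dirichlet_ge0 phi; rewrite (dirichlet_eigenpair lphi).
rewrite pmulr_lge0 // le_eqVlt => /orP[/eqP ac0|ac_gt0]; last first.
  by have := gap _ _ ac_gt0 lphi; lra.
have d0 : dirichlet g phi = 0 by rewrite (dirichlet_eigenpair lphi) -ac0 mul0r.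
have [[u du pu] _] := lphi.
move/eqP: s0; rewrite (eq_bigr (fun v => deg g v * phi u)) => [|v _]; last first.
  have [->|dv] := eqVneq (deg g v) 0; first by rewrite !mul0r.
  by rewrite (harmonic_constant gconn d0 dv du).
rewrite -mulr_suml mulf_eq0 (negPf pu) orbF => /eqP/psumr_eq0P h.
by move/eqP: du; apply; apply: h => // ? _; exact: deg_ge0.
Qed.

(** A negative eigenvalue a of c * centered_form - lap would give the positive
eigenvalue c - a > c of lap. *)
Lemma poincare_upper c : 0 <= c ->
  (forall a phi, 0 < a -> lap_eigenpair g a phi -> a <= c) ->
  forall phi, dirichlet g phi <= c * variance g phi.
Proof.
move=> c_ge0 gap phi; rewrite -subr_ge0 addrC -mulN1r.
apply: pencil_psd => {phi} a phi ephi; rewrite leNgt; apply/negP => a_lt0.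
have [s0 phiE] := eigenpair_pencil (negbT (lt_eqF a_lt0)) ephi.
have lphi : lap_eigenpair g (c - a) phi.
  by split=> [|u]; [case: ephi | apply: oppr_inj; rewrite -[LHS]mulN1r phiE; ring].
have pos : 0 < c - a by lra.
by have := gap _ _ pos lphi; lra.
Qed.

(** Otherwise - lap would be positive semidefinite, but the indicator of a vertex
has positive Dirichlet energy. *)
Lemma exists_positive_eigenpair : (forall u, g u u = 0) ->
  (exists u, deg g u != 0) -> exists a phi, 0 < a /\ lap_eigenpair g a phi.
Proof.
move=> gl [u du]; apply: contrapT => noeig.
pose e v : R := (v == u)%:R.
have : 0 <= \sum_x \sum_y - lap g x y * e x * e y.
  apply: form_psd e => [|x y|x y dx|a phi [phi0 phiE]].
  - exact: deg_ge0.
  - by rewrite lap_sym.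
  - by rewrite lap_supp ?oppr0.
  rewrite leNgt; apply/negP => a_lt0; apply: noeig; exists (- a), phi.
  split; first by rewrite oppr_gt0.
  split=> // x; rewrite mulNr -phiE -sumrN.
  by apply: eq_bigr => y _; rewrite mulNr opprK.
rewrite (bigD1 u) //= [X in _ + X]big1 => [|x /negPf xu]; last first.
  by rewrite big1 // => y _; rewrite /e xu mulr0 mul0r.
rewrite addr0 (bigD1 u) //= [X in _ + X]big1 => [|x /negPf xu]; last first.
  by rewrite /e xu mulr0.
rewrite /e eqxx !mulr1 addr0 /lap gl subr0 eqxx mul1r oppr_ge0.
by rewrite leNgt lt_neqAle eq_sym du deg_ge0.
Qed.
End Graph.
End WeightedGraphs.

(** * Trickling down *)

Section Trickling.
Variables (R : rcfType) (V : finType) (g : V -> V -> R) (G : V -> V -> V -> R).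
Hypotheses (gG : weighted_graph g)
  (degG : forall v u, deg (G v) u = g v u)
  (sumG : forall u x, \sum_v G v u x = g u x).

Let gC u v : g u v = g v u. Proof. by case: gG. Qed.

Let sum_sqnorm phi : \sum_v sqnorm (G v) phi = sqnorm g phi.
Proof.
rewrite exchange_big; apply: eq_bigr => u _ /=; rewrite -mulr_suml.
by congr (_ * _); apply: eq_bigr => v _; rewrite degG gC.
Qed.

Lemma sum_local_dirichlet phi : \sum_v dirichlet (G v) phi = dirichlet g phi.
Proof.
under eq_bigr do rewrite dirichletE; rewrite sumrB sum_sqnorm dirichletE.
congr (_ - _); rewrite exchange_big; apply: eq_bigr => u _ /=.
rewrite -mulr_sumr exchange_big; congr (_ * _); apply: eq_bigr => x _ /=.
by rewrite -mulr_suml sumG.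
Qed.

(** The mean of phi on G v is (1 - a) phi(v), by the eigenvalue equation at v. *)
Lemma sum_local_variance a phi : lap_eigenpair g a phi ->
  \sum_v variance (G v) phi = a * (2 - a) * sqnorm g phi.
Proof.
move=> [_ phiE]; rewrite sumrB sum_sqnorm.
have -> : \sum_v (\sum_u deg (G v) u * phi u) ^+ 2 / (\sum_u deg (G v) u) =
    (1 - a) ^+ 2 * sqnorm g phi.
  rewrite mulr_sumr; apply: eq_bigr => v _.
  under eq_bigr do rewrite degG; under [X in _ / X]eq_bigr do rewrite degG.
  have -> : \sum_u g v u * phi u = (1 - a) * (deg g v * phi v).
    have := phiE v; rewrite lap_apply => h.
    by rewrite mulrBl mul1r -h; ring.
  rewrite -/(deg g v); have [->|dv] := eqVneq (deg g v) 0.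
    by rewrite !(mul0r, mulr0, expr0n).
  by field.
by ring.
Qed.

Lemma trickle_down_lower c a phi : 0 < c -> 0 < a -> lap_eigenpair g a phi ->
  (forall v, c * variance (G v) phi <= dirichlet (G v) phi) -> 2 - c^-1 <= a.
Proof.
move=> c0 a0 e loc; have N0 := eigenpair_sqnorm gG e.
have : c * (a * (2 - a) * sqnorm g phi) <= a * sqnorm g phi.
  rewrite -(sum_local_variance e) -(dirichlet_eigenpair e) -sum_local_dirichlet.
  by rewrite mulr_sumr ler_sum.
rewrite mulrA ler_pM2r // mulrCA ger_pMr // => h.
by rewrite lerBlDl -lerBlDr -(ler_pM2l c0) divff // gt_eqF.
Qed.

Lemma trickle_down_upper c a phi : 0 < c -> 0 < a -> lap_eigenpair g a phi ->
  (forall v, dirichlet (G v) phi <= c * variance (G v) phi) -> a <= 2 - c^-1.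
Proof.
move=> c0 a0 e loc; have N0 := eigenpair_sqnorm gG e.
have : a * sqnorm g phi <= c * (a * (2 - a) * sqnorm g phi).
  rewrite -(sum_local_variance e) -(dirichlet_eigenpair e) -sum_local_dirichlet.
  by rewrite mulr_sumr ler_sum.
rewrite mulrA ler_pM2r // mulrCA ler_pMr // => h.
by rewrite lerBrDl -lerBrDr -(ler_pM2l c0) divff // gt_eqF.
Qed.

End Trickling.

(** * The weighted graph of a link *)

Section LinkGraphs.
Variables (R : realType) (V : finType) (n : nat) (X : {set {set V}}).
Hypotheses (hX : simplicial_complex X) (hpure : pure_dim n X).
Implicit Types (s t : {set V}) (u v x : V).

Lemma simplexS s t : t \in X -> s \subset t -> s \in X.
Proof. by move=> tX st; apply: hX.2 tX st. Qed.

Lemma weight_gt0 t : (0 < weight n X t)%N = (t \in X).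
Proof.
rewrite muln_gt0 fact_gt0 /=; apply/card_gt0P/idP => [[s]|tX].
  by rewrite !inE => /andP[/andP[sX _]]; apply: simplexS.
by have [s sX ts] := hpure tX; exists s; rewrite inE sX.
Qed.

(** Double counting of the pairs (v, e) with e an n-simplex containing t and v a
vertex of e outside t: each e has n + 1 - #|t| such vertices, which is the ratio
of the two factorials. *)
Lemma weight_balance t : (#|t| <= n)%N ->
  (\sum_(v | v \notin t) weight n X (v |: t) = weight n X t)%N.
Proof.
move=> tn; pose F s := [set e in simplices X n%:Z | s \subset e].
transitivity (\sum_(v | v \notin t) (n - #|t|)`! * #|F (v |: t)|)%N.
  by apply: eq_bigr => v vt; rewrite /weight cardsU1 vt add1n subSS.
rewrite -big_distrr /= /weight subSn // factS -mulnA mulnCA -/(F t).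
congr (_ * _)%N; rewrite mulnC.
transitivity (\sum_(v | v \notin t) \sum_(e in F t) (v \in e))%N.
  apply: eq_bigr => v vt; rewrite -sum1_card big_mkcond [RHS]big_mkcond /=.
  apply: eq_bigr => e _; rewrite !inE subUset sub1set.
  by rewrite andbCA; case: (v \in e) => //=; case: ifP.
rewrite exchange_big /= -sum_nat_const; apply: eq_bigr => e.
rewrite !inE => /andP[/andP[_ /eqP en] te].
have ce : #|e| = n.+1 by move: en; rewrite -PoszD => -[->]; rewrite addn1.
rewrite -big_mkcondr /= sum1_card -subSn // -ce -(cardsDS te).
by rewrite -[RHS]cardsE; apply: eq_card => v; rewrite !inE.
Qed.

(** Extending the 1-skeleton of the link to all of V by zero weights puts the
functions on the links of all simplices into the same space. *)
Definition link_graph t u v : R :=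
  if [&& u \notin t, v \notin t & u != v]
  then (weight n X (t :|: [set u; v]))%:R else 0.

Lemma link_graphP t : weighted_graph (link_graph t).
Proof.
split=> [u v|u v]; first by rewrite /link_graph; case: ifP; rewrite ?ler0n.
by rewrite /link_graph setUC eq_sym andbCA (setUC [set u]) (setUC t).
Qed.

Lemma deg_link_graph t u : (#|t| < n)%N ->
  deg (link_graph t) u = if u \notin t then (weight n X (u |: t))%:R else 0.
Proof.
move=> tn; case: ifP => ut; last by rewrite /deg big1 // => v _; rewrite /link_graph ut.
rewrite -[in RHS]weight_balance ?cardsU1 ?ut // natr_sum [RHS]big_mkcond.
apply: eq_bigr => v _; rewrite /link_graph ut !inE negb_or [u == v]eq_sym [(v != u) && _]andbC /=.
by case: ifP => // _; congr (_%:R); congr (weight n X _); apply/setP => x;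
  rewrite !inE; do !case: (_ == _); rewrite ?orbT ?orbF.
Qed.

Lemma deg_link_graph_neq0 t u : t \in X -> (#|t| < n)%N ->
  (deg (link_graph t) u != 0) = ([set u] \in link X t).
Proof.
move=> tX tn; rewrite deg_link_graph // !inE disjoint_sym disjoints1.
case: (boolP (u \in t)) => ut; rewrite ?eqxx ?andbF //=.
rewrite pnatr_eq0 -lt0n weight_gt0 (setUC t) andbC.
by apply/idP/andP => [h|[]//]; split=> //; apply: simplexS h _; rewrite subsetUl.
Qed.

Lemma link_graph_edge t (u v : vertex (link X t)) :
  edge u v = (0 < link_graph t (val u) (val v)).
Proof.
rewrite /edge /link_graph !inE cards2.
have := valP u; have := valP v; rewrite !inE !(disjoint_sym t) !disjoints1.
move=> /and3P[vX vt _] /and3P[uX ut _]; rewrite ut vt /=.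
have [/=|uv] := eqVneq (val u) (val v); first by rewrite ltxx andbF.
rewrite andbT ltr0n weight_gt0; apply/and3P/idP => [[]//|h]; split=> //.
  by apply: simplexS h _; apply: subsetUr.
by rewrite disjoints_subset subUset !sub1set !inE ut vt.
Qed.

Lemma link_graph_connected t : t \in X -> (#|t| < n)%N ->
  connected_skeleton (link X t) -> graph_connected (link_graph t).
Proof.
move=> tX tn conn u v; rewrite !deg_link_graph_neq0 // => uL vL.
pose u' : vertex (link X t) := Sub u uL; pose v' : vertex (link X t) := Sub v vL.
have /connectP[p pth /(congr1 val) /= vE] := conn u' v'.
apply/connectP; exists (map val p); last by rewrite -[u]/(val u') last_map.
rewrite -[u]/(val u') path_map; apply: sub_path pth => x y /=.
by rewrite link_graph_edge.
Qed.

Lemma laplacian_apply t (psi : V -> R) (u : vertex (link X t)) :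
  t \in X -> (#|t| < n)%N ->
  deg (link_graph t) (val u) * laplacian n [ffun v => psi (val v)] u =
  \sum_v lap (link_graph t) (val u) v * psi v.
Proof.
move=> tX tn; rewrite lap_apply !ffunE mulrBr; congr (_ - _).
have du : deg (link_graph t) (val u) != 0 by rewrite deg_link_graph_neq0 // (valP u).
have degE : deg (link_graph t) (val u) = (weight n X (t :|: [set val u]))%:R.
  by move: du; rewrite deg_link_graph //; case: ifP; rewrite ?eqxx // setUC.
rewrite mulr_sumr.
transitivity (\sum_(v | [set v] \in link X t) link_graph t (val u) v * psi v).
  rewrite (big_sub [pred v | [set v] \in link X t]) big_mkcond /=.
  apply: eq_bigr => v _; rewrite link_graph_edge ffunE; case: ifP => [guv|].
    rewrite -degE mulrA; congr (_ * _).
    move: guv; rewrite /link_graph; case: ifP; rewrite ?ltxx // => _ _.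
    by rewrite mulrC divfK.
  move=> /negbT; rewrite -leNgt => guv.
  suff -> : link_graph t (val u) (val v) = 0 by rewrite mul0r.
  by apply/le_anti; rewrite guv; have [-> _] := link_graphP t.
rewrite big_mkcond; apply: eq_bigr => v _; case: ifP => // /negbT.
rewrite -deg_link_graph_neq0 // negbK => /eqP dv.
by case: (link_graphP t) => _ ->; rewrite (deg0 (link_graphP t)) ?mul0r.
Qed.

Lemma positive_eigenvalueP t a : t \in X -> (#|t| < n)%N ->
  positive_eigenvalue n X t a <->
  0 < a /\ exists phi, lap_eigenpair (link_graph t) a phi.
Proof.
move=> tX tn; have lapE psi (u : vertex (link X t)) := laplacian_apply psi u tX tn.
split=> -[a0]; [case=> phi phi0 phiE|case=> psi [[u du psiu] psiE]]; split=> //.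
  pose psi v := if insub v is Some x then phi x else 0.
  have psiK : [ffun v => psi (val v)] = phi.
    by apply/ffunP => v; rewrite ffunE /psi valK.
  exists psi; split.
    have /existsP[u pu] : [exists u, phi u != 0].
      apply: contraNT phi0 => /existsPn h; apply/eqP/ffunP => u.
      by rewrite ffunE; apply/eqP; rewrite -[_ == _]negbK h.
    by exists (val u); rewrite ?deg_link_graph_neq0 ?(valP u) // /psi valK.
  move=> u; have [du|du] := eqVneq (deg (link_graph t) u) 0.
    rewrite du mul0r mulr0 big1 // => v _.
    by rewrite (lap_supp (link_graphP t)) ?mul0r.
  rewrite deg_link_graph_neq0 // in du.
  pose u' : vertex (link X t) := Sub u du.
  have pu : phi u' = psi u by rewrite -psiK ffunE.
  rewrite -(lapE psi u') psiK phiE ffunE -pu.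
  exact: mulrCA.
rewrite deg_link_graph_neq0 // in du.
exists [ffun v => psi (val v)].
  apply/eqP => /ffunP/(_ (Sub u du)); rewrite !ffunE /= => /eqP.
  by rewrite (negPf psiu).
apply/ffunP => v; have dv : deg (link_graph t) (val v) != 0.
  by rewrite deg_link_graph_neq0 ?(valP v).
by apply: (mulfI dv); rewrite lapE psiE !ffunE mulrCA.
Qed.

Lemma link_eigenvalue_exists t : t \in X -> (#|t| < n)%N ->
  exists a : R, positive_eigenvalue n X t a.
Proof.
move=> tX tn.
have [||a [phi [a0 e]]] := exists_positive_eigenpair (link_graphP t).
- by move=> u; rewrite /link_graph eqxx !andbF.
- have [s] := hpure tX; rewrite inE -PoszD addn1 => /andP[sX /eqP[sn]] ts.
  have /card_gt0P[u] : (0 < #|s :\: t|)%N by rewrite cardsDS // sn subn_gt0 ltnS ltnW.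
  rewrite inE => /andP[ut us]; exists u.
  rewrite deg_link_graph // ut pnatr_eq0 -lt0n weight_gt0.
  by apply: simplexS sX _; rewrite subUset sub1set us.
by exists a; apply/positive_eigenvalueP => //; split=> //; exists phi.
Qed.

Lemma link_eigenvalues_finite t : t \in X -> (#|t| < n)%N ->
  exists r : seq R, forall a, positive_eigenvalue n X t a -> a \in r.
Proof.
move=> tX tn; have gG := link_graphP t.
have [r rP] := eigenvalues_finite (deg_ge0 gG) (lap_sym gG) (lap_supp gG).
by exists r => a /(positive_eigenvalueP _ tX tn)[_ [phi /rP]].
Qed.

Lemma lambda_linkP t : t \in X -> (#|t| < n)%N ->
  positive_eigenvalue n X t (lambda_link R n X t) /\
  forall b, positive_eigenvalue n X t b -> lambda_link R n X t <= b.
Proof.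
move=> tX tn; have [r rP] := link_eigenvalues_finite tX tn.
have [a aP amin] := seq_extremum le_total le_trans rP (link_eigenvalue_exists tX tn).
by rewrite /lambda_link; case: classical_sets.xgetP => [b -> []//|/(_ a)[]].
Qed.

Lemma kappa_linkP t : t \in X -> (#|t| < n)%N ->
  positive_eigenvalue n X t (kappa_link R n X t) /\
  forall b, positive_eigenvalue n X t b -> b <= kappa_link R n X t.
Proof.
move=> tX tn; have [r rP] := link_eigenvalues_finite tX tn.
have [a aP amax] := seq_extremum ge_total ge_trans rP (link_eigenvalue_exists tX tn).
by rewrite /kappa_link; case: classical_sets.xgetP => [b -> []//|/(_ a)[]].
Qed.

(** The guard matters: for v in t, v |: t is t itself, and its graph must not be
counted in the sum of the local graphs. *)
Definition vertex_link_graph t v : V -> V -> R :=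
  if v \notin t then link_graph (v |: t) else fun _ _ => 0.

Lemma vertex_link_graphP t v : weighted_graph (vertex_link_graph t v).
Proof. by rewrite /vertex_link_graph; case: ifP => // _; apply: link_graphP. Qed.

Lemma deg_vertex_link_graph t v u : (#|t|.+1 < n)%N ->
  deg (vertex_link_graph t v) u = link_graph t v u.
Proof.
move=> tn; rewrite /vertex_link_graph /link_graph; case: ifP => vt /=; last first.
  by rewrite /deg big1.
rewrite deg_link_graph ?cardsU1 ?vt // !inE negb_or andbC eq_sym.
case: ifP => // _; congr (_%:R); congr (weight n X _).
by apply/setP => x; rewrite !inE; do !case: (_ == _); rewrite ?orbT ?orbF.
Qed.

Lemma sum_vertex_link_graph t u x : (#|t|.+1 < n)%N ->
  \sum_v vertex_link_graph t v u x = link_graph t u x.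
Proof.
move=> tn; rewrite /link_graph; case: ifP => [/and3P[ut xt ux]|nux]; last first.
  rewrite big1 // => v _; rewrite /vertex_link_graph; case: ifP => // vt.
  rewrite /link_graph; case: ifP => // /and3P[].
  rewrite !inE !negb_or => /andP[_ ut] /andP[_ xt] ux.
  by rewrite ut xt ux in nux.
have cux : (#|t :|: [set u; x]| <= n)%N.
  apply: leq_trans (leq_card_setU _ _) _.
  by rewrite cards2 ux addn2.
rewrite -(weight_balance cux) natr_sum [RHS]big_mkcond.
apply: eq_bigr => v _; rewrite /vertex_link_graph !inE !negb_or.
case: (v \in t) => //=; rewrite /link_graph !inE !negb_or ut xt ux !andbT.
by rewrite [u == v]eq_sym [x == v]eq_sym (setUA [set v]).
Qed.

End LinkGraphs.

(** * Iterates of f *)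

Section Iterates.
Variable R : realType.
Implicit Types (x : R) (l m : nat).

(** The function f maps (p - 1) / p to (p - 2) / (p - 1) and is increasing on
positive reals, so each application lowers p by one. *)
Lemma iter_f_gt l m x : (m.+1%:R - 1) / m.+1%:R < x -> (l <= m)%N ->
  ((m - l).+1%:R - 1) / (m - l).+1%:R < iter l (@f R) x.
Proof.
move=> hx; elim: l => [|l IH] lm; first by rewrite subn0.
have := IH (ltnW lm); rewrite subnSK // iterS; move: (iter l _ x) => y.
set p := (m - l)%N; have : (0 < p)%N by rewrite subn_gt0.
case: p => // p _ hy.
have p0 : 0 < p.+1%:R :> R by rewrite ltr0n.
have pE : p.+2%:R = p.+1%:R + 1 :> R by rewrite -natr1.
have hy' : p.+1%:R / (p.+1%:R + 1) < y by move: hy; rewrite pE addrK.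
have y0 : 0 < y by apply: lt_trans hy'; rewrite divr_gt0 // addr_gt0.
rewrite /f; move: (p.+1%:R : R) p0 hy' => q p0 hy'.
rewrite (_ : (q - 1) / q = 2 - (q / (q + 1))^-1); last first.
  have q1 : 0 < q + 1 by rewrite addr_gt0.
  by field; rewrite !gt_eqF.
by rewrite ltrD2l ltrN2 ltf_pV2 // posrE divr_gt0 // addr_gt0.
Qed.

Lemma iter_f_gt0 l n x : (n%:R - 1) / n%:R < x -> (l < n)%N ->
  0 < iter l (@f R) x.
Proof.
case: n => // m hx lm; apply: le_lt_trans (iter_f_gt hx lm).
by rewrite divr_ge0 // subr_ge0 ler1n.
Qed.

(** The numerator of the l-th expression is the denominator of the next one, so
the nonvanishing of the iterates is exactly what the induction divides by. *)
Lemma iter_fE l x : (forall i, (i < l)%N -> iter i (@f R) x != 0) ->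
  iter l (@f R) x = ((l%:R + 1) * x - l%:R) / (l%:R * x - (l%:R - 1)).
Proof.
elim: l => [|l IH] nz; first by rewrite !(mul0r, add0r, mul1r, subr0, opprK, divr1).
have := nz l (ltnSn l); rewrite iterS IH => [|i il]; last by apply: nz; apply: ltnW.
rewrite mulf_eq0 invr_eq0 negb_or => /andP[N0 D0].
rewrite -(natr1 l) /f.
move: (l%:R : R) N0 D0 => q N0 D0; field.
by rewrite D0 addrK N0.
Qed.

End Iterates.

(** * Descent through the links *)

Lemma spectral_gap_descent (R : realType) (V : finType) (n : nat)
    (X : {set {set V}}) (lambda kappa : R) :
  simplicial_complex X -> pure_dim n X -> lambda <= kappa ->
  two_sided_expansion n X lambda kappa ->
  forall l t, t \in X -> (#|t| + l).+1 = n ->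
  forall a phi, 0 < a -> lap_eigenpair (link_graph R n X t) a phi ->
    iter l (@f R) lambda <= a <= iter l (@f R) kappa.
Proof.
move=> hX hpure lk [hl _ _ conn loc]; elim=> [|l IH] t tX tl a phi a0 e.
  have tn : (#|t| < n)%N by rewrite -tl addn0.
  have tS : t \in simplices X (n%:Z - 2) by rewrite inE tX -tl addn0 /=; lia.
  have pa : positive_eigenvalue n X t a.
    by apply/(positive_eigenvalueP hX hpure) => //; split=> //; exists phi.
  have [ll kk] := loc t tS.
  have [_ /(_ a pa) la] := lambda_linkP R hX hpure tX tn.
  have [_ /(_ a pa) ka] := kappa_linkP R hX hpure tX tn.
  by rewrite /= (le_trans ll la) (le_trans ka kk).
have tn : (#|t|.+1 < n)%N by rewrite -tl addnS !ltnS leq_addr.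
have ln : (l < n)%N by rewrite -tl addnS -addSn ltnS leq_addl.
have lam0 := iter_f_gt0 hl ln.
have kap0 : 0 < iter l (@f R) kappa by apply: iter_f_gt0 ln; apply: lt_le_trans lk.
(* A graph with an eigenpair has an edge, which forces v |: t to be a simplex:
   at the other points v the bounds hold vacuously. *)
have gap v b psi : 0 < b -> lap_eigenpair (vertex_link_graph R n X t v) b psi ->
    iter l (@f R) lambda <= b <= iter l (@f R) kappa.
  move=> b0 eb; have [[u]] := eb; rewrite deg_vertex_link_graph // => gvu _ _.
  have dv : deg (link_graph R n X t) v != 0.
    by apply: contra_neq gvu; apply: deg0; apply: link_graphP.
  move: dv eb; rewrite deg_link_graph 1?ltnW // /vertex_link_graph.
  case: ifP => [vt|]; rewrite ?eqxx // pnatr_eq0 -lt0n weight_gt0 // => vX.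
  by apply: IH => //; rewrite cardsU1 vt -tl addnS addSn.
have gconn v : graph_connected (vertex_link_graph R n X t v).
  rewrite /vertex_link_graph; case: ifP => vt; last first.
    by move=> u u'; rewrite /deg big1 ?eqxx.
  have [vX|vX] := boolP (v |: t \in X).
    have cvt : (#|v |: t| < n)%N by rewrite cardsU1 vt.
    apply: link_graph_connected => //; apply: (conn (#|v |: t|%:Z - 1)).
      by lia.
    by rewrite inE vX subrK eqxx.
  move=> u u'; rewrite deg_link_graph ?cardsU1 ?vt //; case: ifP; rewrite ?eqxx // => _.
  rewrite pnatr_eq0 -lt0n weight_gt0 // => /(simplexS hX)/(_ (subsetUr _ _)).
  by rewrite (negPf vX).
have degG v u := deg_vertex_link_graph R X v u tn.
have sumG u x := sum_vertex_link_graph R X u x tn.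
have gG := link_graphP R n X t.
apply/andP; split.
  apply: (trickle_down_lower gG degG sumG lam0 a0 e) => v.
  apply: poincare_lower => //; first exact: vertex_link_graphP.
  by move=> b psi b0 eb; case/andP: (gap v b psi b0 eb).
apply: (trickle_down_upper gG degG sumG kap0 a0 e) => v.
apply: poincare_upper (ltW kap0) _ _; first exact: vertex_link_graphP.
by move=> b psi b0 eb; case/andP: (gap v b psi b0 eb).
Qed.

Theorem theorem1p4 (R : realType) (V : finType) (n : nat) (X : {set {set V}})
    (lambda kappa : R)
    (hn : (1 <= n)%N)
    (hX : simplicial_complex X)
    (hpure : pure_dim n X)
    (hlambda : (n%:R - 1) / n%:R < lambda)
    (hkappa : lambda <= kappa)
    (hexp : two_sided_expansion n X lambda kappa) :
  (forall (k : int) (tau : {set V}),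
     -1 <= k <= n%:Z - 2 -> tau \in simplices X k ->
     iter (absz (n%:Z - k - 2)%R) (@f R) lambda <= lambda_link R n X tau /\
     kappa_link R n X tau <= iter (absz (n%:Z - k - 2)%R) (@f R) kappa) /\
  (forall (l : nat) (x : R),
     (forall i : nat, (i < l)%N -> iter i (@f R) x != 0) ->
     iter l (@f R) x = ((l%:R + 1) * x - l%:R) / (l%:R * x - (l%:R - 1))).
Proof.
split=> [k tau hk|]; last by move=> l x; apply: iter_fE.
rewrite inE => /andP[tX /eqP tk].
have tn : (#|tau| < n)%N by lia.
set l := absz _; have tl : (#|tau| + l).+1 = n by rewrite /l; lia.
have gap := spectral_gap_descent hX hpure hkappa hexp tX tl.
have bound a : positive_eigenvalue n X tau a ->
    iter l (@f R) lambda <= a <= iter l (@f R) kappa.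
  by move=> /(positive_eigenvalueP hX hpure _ tX tn)[a0 [phi]]; apply: gap.
have [/bound/andP[la _] _] := lambda_linkP R hX hpure tX tn.
have [/bound/andP[_ ka] _] := kappa_linkP R hX hpure tX tn.
by split.
Qed.
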